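(* Let $P(z)\in\mathbb{R}[z]$ be a polynomial with non-negative coefficients and let $p\in\mathbb{R}[x,y]$ be a polynomial such that $2\deg(P)>\deg(p)\geq 2$. Let $f:\mathbb{R}^2\to\mathbb{R}$ be defined by $f(x,y)=P(x^2+y^2)+p(x,y)$. Then $\mathbb{R}^2\setminus \mathrm{Hess}^+(f)$ is bounded.
   Context: For a $C^2$-smooth function $f:\mathbb{R}^n\to\mathbb{R}$, $H_x(f)$ denotes the Hessian matrix of $f$ at $x$, and $\mathrm{Hess}^+(f)=\{x\in\mathbb{R}^n : H_x(f)\text{ is positive definite}\}$. Here $\deg(p)$ is the total degree of $p$. *)

(* Defs.v *)
From mathcomp Require Import all_boot all_order all_algebra.
From mathcomp Require Import all_classical all_reals all_analysis.
(* The notations of mpoly clash with those of analysis. *)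
From mathcomp Require Import -(notations) mpoly.
Import Order.TTheory GRing.Theory Num.Theory.
Import numFieldNormedType.Exports.

Set Implicit Arguments.
Unset Strict Implicit.
Unset Printing Implicit Defensive.

Local Open Scope classical_set_scope.
Local Open Scope ring_scope.

(* Both degrees are 0 on the zero polynomial; msize and size are degree + 1. *)
Definition total_degree (n : nat) (R : nzRingType) (p : mpoly n R) : nat :=
  (msize p).-1.

Definition degree (R : nzRingType) (P : {poly R}) : nat := (size P).-1.

(* Points of R^n are row vectors, so delta_mx 0 i is the i-th basis vector. *)
Definition hessian (R : realType) (n : nat) (f : 'rV[R]_n -> R) (x : 'rV[R]_n) :
    'M[R]_n :=
  \matrix_(i < n, j < n) 'D_(delta_mx 0 i) ('D_(delta_mx 0 j) f) x.

Definition posdefmx (R : realType) (n : nat) (A : 'M[R]_n) : Prop :=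
  A^T = A /\ forall v : 'rV[R]_n, v != 0 -> 0 < (v *m A *m v^T) 0 0.

Definition HessPos (R : realType) (n : nat) (f : 'rV[R]_n -> R) :
    set 'rV[R]_n :=
  [set x | posdefmx (hessian f x)].

(* Main.v *)
(* Writing r = |x|^2, the Hessian of P(|x|^2) at x is the form
   w |-> 2 P'(r) |w|^2 + 4 P''(r) <x, w>^2, which is at least 2 P'(r) |w|^2
   since P has non-negative coefficients.  With d = deg P this grows at least
   like |x|^(2d-2) |w|^2, whereas the Hessian of p is O(|x|^(deg p - 2)) and
   deg p - 2 <= 2d - 3.  Norms on R^2 being equivalent, the sup norm serves for
   |x| in the growth estimates.  All second derivatives are computed formally
   on the polynomial P(X_1^2 + ... + X_n^2) + p. *)
Require Import Defs.
From mathcomp Require Import all_boot all_order all_algebra.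
From mathcomp Require Import all_classical all_reals all_analysis.
From mathcomp Require Import -(notations) mpoly.
From mathcomp Require Import ring lra zify.
Import Order.TTheory GRing.Theory Num.Theory.
Import numFieldNormedType.Exports.

Set Implicit Arguments.
Unset Strict Implicit.
Unset Printing Implicit Defensive.

Local Open Scope classical_set_scope.
Local Open Scope ring_scope.

(** Matrix-valued maps are differentiated entrywise; this is applied to the identity. *)
Lemma is_derive_coord (R : realType) (m n : nat) (i : 'I_m) (j : 'I_n)
    (x u : 'M[R]_(m, n)) :
  is_derive x u (fun y : 'M[R]_(m, n) => y i j) (u i j).
Proof.
have did : derivable (id : 'M[R]_(m, n) -> 'M[R]_(m, n)) x u.
  exact: derivable_id.
split; first by move/derivable_mxP : did; exact.
by have := derive_mx did; rewrite derive_id => /matrixP/(_ i j); rewrite mxE.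
Qed.

(** Every monomial is a product of variables, so the derivative of [meval] needs checking only on
    constants and variables, and under sums and products. *)
Lemma mpoly_alg_ind (n : nat) (R : comNzRingType) (Q : mpoly n R -> Prop) :
    (forall c, Q (mpolyC n c)) -> (forall i, Q (mpolyX R (mnm1 i))) ->
    (forall p q, Q p -> Q q -> Q (p + q)) ->
    (forall p q, Q p -> Q q -> Q (p * q)) ->
  forall p, Q p.
Proof.
move=> QC QX QD QM; elim/mpolyind => [|c m p _ _ Qp]; first by rewrite -mpolyC0.
apply: QD Qp; rewrite -mul_mpolyC; apply: (QM _ _ (QC c)).
rewrite mpolyXE_id; apply: big_ind => [|p1 p2|i _].
- by rewrite -mpolyC1.
- exact: QM.
- elim: (m i) => [|k IHk]; first by rewrite expr0 -mpolyC1.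
  by rewrite exprS; apply: QM.
Qed.

Lemma mderivXU (n : nat) (R : nzRingType) (i j : 'I_n) :
  mderiv i (mpolyX R (mnm1 j)) = (i == j)%:R.
Proof.
rewrite mderivX mnm1E eq_sym; case: eqP => [->|_]; last by rewrite scale0r.
have -> : mnm_sub (mnm1 j) (mnm1 j) = mnm0.
  by apply/mnmP => k; rewrite mnmBE subnn mnm0E.
by rewrite scale1r mpolyX0.
Qed.

Lemma is_derive_meval (R : realType) (n : nat) (q : mpoly n R) (i : 'I_n)
    (x : 'rV[R]_n) :
  is_derive x (delta_mx 0 i) (fun y => meval (y 0) q)
    (meval (x 0) (mderiv i q)).
Proof.
elim/mpoly_alg_ind : q => [c|j|p q dp dq|p q dp dq].
- rewrite mderivC meval0; under eq_fun do rewrite mevalC; exact: is_derive_cst.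
- under eq_fun do rewrite mevalXU.
  apply: is_derive_eq (is_derive_coord _ _ _ _) _.
  by rewrite mderivXU rmorph_nat mxE eqxx eq_sym.
- under eq_fun do rewrite mevalD.
  by rewrite mderivD mevalD; exact: is_deriveD.
- under eq_fun do rewrite mevalM.
  apply: is_derive_eq (is_deriveM dp dq) _.
  by rewrite mderivM mevalD !mevalM addrC /GRing.scale /= mulrC.
Qed.

Lemma hessian_meval (R : realType) (n : nat) (q : mpoly n R) (x : 'rV[R]_n)
    (i j : 'I_n) :
  hessian (fun y => meval (y 0) q) x i j = meval (x 0) (mderiv i (mderiv j q)).
Proof.
rewrite mxE.
have -> : 'D_(delta_mx 0 j) (fun y : 'rV[R]_n => meval (y 0) q) =
    fun y : 'rV[R]_n => meval (y 0) (mderiv j q).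
  apply/funext => y.
  by rewrite (@derive_val _ _ _ _ _ _ _ (is_derive_meval q j y)).
by rewrite (@derive_val _ _ _ _ _ _ _ (is_derive_meval _ i x)).
Qed.

Definition mhorner (n : nat) (R : comNzRingType) (P : {poly R})
    (q : mpoly n R) :
  mpoly n R := (map_poly (mpolyC n (R:=R)) P).[q].

Lemma meval_mhorner (n : nat) (R : comNzRingType) (P : {poly R}) (q : mpoly n R)
    (v : 'I_n -> R) :
  meval v (mhorner P q) = P.[meval v q].
Proof.
rewrite /mhorner -horner_map -map_poly_comp map_poly_id //= => c _.
exact: mevalC.
Qed.

Lemma mderiv_mhorner (n : nat) (R : comNzRingType) (P : {poly R})
    (q : mpoly n R) (i : 'I_n) :
  mderiv i (mhorner P q) = mhorner P^`() q * mderiv i q.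
Proof.
rewrite /mhorner; elim/poly_ind : P => [|P c IHP].
  by rewrite deriv0 !rmorph0 !horner0 mderiv0 mul0r.
rewrite derivMXaddC !(rmorphD, rmorphM) /= map_polyX map_polyC !hornerE /=.
rewrite mderivD mderivM mderivC addr0 IHP; ring.
Qed.

Definition norm2 (n : nat) (R : nzRingType) : mpoly n R :=
  \sum_(i < n) mpolyX R (mnm1 i) ^+ 2.

Lemma meval_norm2 (n : nat) (R : comNzRingType) (v : 'I_n -> R) :
  meval v (norm2 n R) = \sum_i v i ^+ 2.
Proof.
by rewrite rmorph_sum; apply: eq_bigr => i _; rewrite rmorphXn /= mevalXU.
Qed.

Lemma mderiv_norm2 (n : nat) (R : comNzRingType) (i : 'I_n) :
  mderiv i (norm2 n R) = mpolyX R (mnm1 i) *+ 2.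
Proof.
rewrite raddf_sum (bigD1 i) //= big1 ?addr0 => [|j /negPf ji].
  by rewrite expr2 mderivM mderivXU eqxx mul1r mulr1 -mulr2n.
by rewrite expr2 mderivM mderivXU eq_sym ji mul0r mulr0 addr0.
Qed.

(** By the chain rule the [j]-th partial derivative is $2 v_j P'(r)$; the product rule then gives
    the diagonal term and the rank-one term. *)
Lemma meval_hessian_radial (n : nat) (R : comNzRingType) (P : {poly R})
    (v : 'I_n -> R) (i j : 'I_n) (r := \sum_k v k ^+ 2) :
  meval v (mderiv i (mderiv j (mhorner P (norm2 n R)))) =
  (P^`().[r] *+ 2) *+ (i == j) + (P^`()^`().[r] *+ 4) * (v i * v j).
Proof.
rewrite !(mderiv_mhorner, mderivM, mderiv_norm2, mderivMn, mderivXU).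
rewrite mevalD !mevalM !mevalMn !mevalXU !meval_mhorner meval_norm2 -/r.
by case: eqP => _; rewrite ?(mulr1n, mulr0n, rmorph1, rmorph0); ring.
Qed.

Lemma mulmx_quadE (R : comNzRingType) (n : nat) (A : 'M[R]_n) (w : 'rV[R]_n) :
  (w *m A *m w^T) 0 0 = \sum_i \sum_j A i j * (w 0 i * w 0 j).
Proof.
rewrite exchange_big /= mxE; apply: eq_bigr => j _.
by rewrite !mxE mulr_suml; apply: eq_bigr => i _; ring.
Qed.

(** Bound each $|w_i w_j|$ by $(w_i^2 + w_j^2)/2$; every square then occurs [n] times in total. *)
Lemma quad_form_norm_le (R : realFieldType) (n : nat) (B : 'M[R]_n) (b : R)
    (w : 'rV[R]_n) :
  (forall i j, `|B i j| <= b) ->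
  `|(w *m B *m w^T) 0 0| <= b * n%:R * \sum_i w 0 i ^+ 2.
Proof.
move=> Bb; rewrite mulmx_quadE.
have -> : b * n%:R * \sum_i w 0 i ^+ 2 =
    \sum_i \sum_(j < n) b * ((w 0 i ^+ 2 + w 0 j ^+ 2) / 2).
  under [RHS]eq_bigr do
    rewrite -mulr_sumr -mulr_suml big_split /= sumr_const card_ord.
  rewrite -[RHS]mulr_sumr -mulr_suml big_split /= sumr_const card_ord sumrMnl.
  by rewrite -mulrA -mulr_natl; field.
apply: le_trans (ler_norm_sum _ _ _) _; apply: ler_sum => i _.
apply: le_trans (ler_norm_sum _ _ _) _; apply: ler_sum => j _.
rewrite normrM; apply: ler_pM => //; rewrite normrM.
rewrite -(real_normK (num_real (w 0 i))) -(real_normK (num_real (w 0 j))).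
have := sqr_ge0 (`|w 0 i| - `|w 0 j|); nra.
Qed.

Lemma sum_sqr_gt0 (R : realDomainType) (n : nat) (w : 'rV[R]_n) :
  w != 0 -> 0 < \sum_i w 0 i ^+ 2.
Proof.
move=> w0; rewrite lt0r sumr_ge0 ?andbT; last by move=> i _; exact: sqr_ge0.
apply: contraNneq w0 => /eqP; rewrite psumr_eq0; last first.
  by move=> i _; exact: sqr_ge0.
move=> /allP w0; apply/eqP/rowP => i; apply/eqP; rewrite mxE -sqrf_eq0.
by apply: (implyP (w0 i _)) => //; rewrite mem_index_enum.
Qed.

(** As [1 <= N], a monomial of degree at most [k] is at most [N ^+ k]. The absolute values of the
    coefficients, summed over the whole family, give a uniform constant. *)
Lemma meval_growth (R : realFieldType) (n k : nat) (I : finType)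
    (q : I -> mpoly n R) :
    (forall i, msize (q i) <= k.+1)%N ->
  exists2 C : R, 0 <= C & forall (N : R) (v : 'I_n -> R),
    1 <= N -> (forall j, `|v j| <= N) ->
    forall i, `|meval v (q i)| <= C * N ^+ k.
Proof.
move=> qk; pose c i := \sum_(m <- msupp (q i)) `|mcoeff m (q i)|.
have c0 i : 0 <= c i by apply: sumr_ge0.
exists (\sum_i c i); first exact: sumr_ge0.
move=> N v N1 vN i; have N0 := le_trans ler01 N1.
apply: (@le_trans _ _ (c i * N ^+ k)); last first.
  rewrite ler_wpM2r ?exprn_ge0 // (bigD1 i) //= lerDl; exact: sumr_ge0.
rewrite mevalE mulr_suml.
apply: le_trans (ler_norm_sum _ _ _) _; rewrite !big_seq.
apply: ler_sum => m mq.
rewrite normrM; apply: ler_wpM2l => //; rewrite normr_prod.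
have mk : (mdeg m <= k)%N by rewrite -ltnS (leq_trans (msize_mdeg_lt mq)).
apply: le_trans (ler_weXn2l N1 mk).
rewrite mdegE -prodrXr; apply: ler_prod => j _.
by rewrite normrX exprn_ge0 //=; apply: lerXn2r.
Qed.

(** A monomial [m] of the derivative comes from $m + e_i$ in [q], of degree one more. *)
Lemma msize_mderiv (R : nzRingType) (n k : nat) (q : mpoly n R) (i : 'I_n) :
  (msize q <= k.+1)%N -> (msize (mderiv i q) <= k)%N.
Proof.
move=> qk; rewrite msizeE big_seq; apply/bigmax_leqP_seq => m mq _.
have : mcoeff (mnm_add m (mnm1 i)) q != 0.
  move: mq; rewrite mcoeff_msupp mcoeff_mderiv.
  by apply: contraNneq => ->; rewrite mul0rn.
rewrite -mcoeff_msupp => /msize_mdeg_lt; rewrite mdegD mdeg1 addn1 => h.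
by rewrite -ltnS (leq_trans h).
Qed.

Lemma coef_deriv_ge0 (R : numDomainType) (P : {poly R}) :
  (forall i, 0 <= P`_i) -> forall i, 0 <= P^`()`_i.
Proof. by move=> P0 i; rewrite coef_deriv mulrn_wge0. Qed.

Lemma horner_ge_monomial (R : numDomainType) (P : {poly R}) (x : R) (k : nat) :
  (forall i, 0 <= P`_i) -> 0 <= x -> P`_k * x ^+ k <= P.[x].
Proof.
move=> P0 x0.
(* Padding the expansion with zero coefficients makes [k] a valid index even beyond the degree. *)
have kP : (k < maxn (size P) k.+1)%N by rewrite leq_max leqnn orbT.
rewrite (@horner_coef_wide _ (maxn (size P) k.+1)) ?leq_maxl //.
rewrite (bigD1 (Ordinal kP)) //= lerDl.
by apply: sumr_ge0 => i _; rewrite mulr_ge0 ?exprn_ge0.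
Qed.

Theorem theorem3p1 (R : realType) (P : {poly R}) (p : mpoly 2 R)
    (f : 'rV[R]_2 -> R)
    (hP : forall i : nat, 0 <= P`_i)
    (hdeg : (total_degree p < 2 * degree P)%N)
    (hp : (2 <= total_degree p)%N)
    (hf : forall v : 'rV[R]_2,
      f v = P.[v 0 0 ^+ 2 + v 0 1 ^+ 2] + meval (fun i : 'I_2 => v 0 i) p) :
  bounded_set (~` HessPos f).
Proof.
pose q := mhorner P (norm2 2 R) + p.
have fE : f = fun v => meval (v 0) q.
  apply/funext => v; rewrite hf mevalD meval_mhorner meval_norm2.
  rewrite big_ord_recl big_ord1; congr (P.[_ + v 0 _ ^+ 2] + _).
  exact/val_inj.
(* The two degree hypotheses give $2 \deg P \geq 3$, hence $\deg P \geq 2$. *)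
have [d dE] : exists d, degree P = d.+2.
  by exists (degree P).-2; move: hdeg hp; case: (degree P) => [|[|d]] //; lia.
have ltP : 0 < P`_d.+2.
  rewrite lt0r hP andbT -dE /degree -lead_coefE lead_coef_eq0.
  by apply: contra_eq_neq dE => ->; rewrite /degree size_poly0.
(* Here $\deg p \leq 2d + 3$, and two derivatives lower this to $2d + 1$. Indexing by pairs gives
   one constant for all entries. *)
have [C C0 HC] : exists2 C : R, 0 <= C & forall (N : R) (v : 'I_2 -> R),
    1 <= N -> (forall j, `|v j| <= N) -> forall ij : 'I_2 * 'I_2,
    `|meval v (mderiv ij.1 (mderiv ij.2 p))| <= C * N ^+ (2 * d).+1.
  apply: meval_growth => ij; do 2 apply: msize_mderiv.
  by move: hdeg; rewrite dE /total_degree; case: (mmeasure _ _) => [|m] /=; lia.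
(* The leading coefficient of $P'$. *)
pose c : R := P`_d.+2 *+ d.+2.
have c0 : 0 < c by rewrite mulrn_wgt0.
(* Beyond this radius both [1 <= N] and [C < c * N] hold. *)
exists (1 + C / c); split; first exact: num_real.
move=> M MC x; apply: contra_notT; rewrite -ltNge => /(lt_trans MC) xN.
pose N := `|x|.
have N1 : 1 <= N by apply: le_trans (ltW xN); rewrite lerDl divr_ge0 // ltW.
have NC : C < c * N.
  by rewrite mulrC -ltr_pdivrMr //; apply: lt_trans xN; rewrite ltrDr ltr01.
have xj j : `|x 0 j| <= N.
  rewrite /N [`|x|]mx_normrE.
  exact: (le_bigmax _ (fun ij => `|x ij.1 ij.2|) (0, j)).
pose r := \sum_k x 0 k ^+ 2.
have rN : N ^+ 2 <= r.
  (* The sup norm is attained at some coordinate, whose square is a term of [r]. *)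
  have /mx_norm_neq0[[i k] xN'] : N != 0.
    by rewrite gt_eqF // (lt_le_trans ltr01).
  rewrite /N [`|x|]xN' (ord1 i) real_normK ?num_real // /r (bigD1 k) //= lerDl.
  by apply: sumr_ge0 => l _; exact: sqr_ge0.
have r0 : 0 <= r := le_trans (sqr_ge0 N) rN.
(* Keep only the leading term of $P'(r)$ and use $r^{d+1} \geq N^{2d+2}$. *)
have P1 : c * N ^+ (2 * d).+2 <= P^`().[r].
  apply: le_trans (horner_ge_monomial d.+1 (coef_deriv_ge0 hP) r0).
  rewrite coef_deriv -/c ler_wpM2l ?(ltW c0) //.
  rewrite -addn2 -mulnSr exprM.
  by apply: lerXn2r; rewrite ?nnegrE ?sqr_ge0.
have P2 : 0 <= P^`()^`().[r].
  have P20 := coef_deriv_ge0 (coef_deriv_ge0 hP).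
  apply: le_trans (horner_ge_monomial 0 P20 r0).
  by rewrite mulr1.
split.
  by apply/matrixP => i j; rewrite fE mxE !hessian_meval mderiv_comm.
move=> w w0.
pose B := \matrix_(i < 2, j < 2) meval (x 0) (mderiv i (mderiv j p)).
(* The rank-one part of the radial Hessian becomes the square of $\langle x, w \rangle$. *)
have -> : (w *m hessian f x *m w^T) 0 0 =
    (P^`().[r] *+ 2) * \sum_i w 0 i ^+ 2 +
    (P^`()^`().[r] *+ 4) * (\sum_i x 0 i * w 0 i) ^+ 2 + (w *m B *m w^T) 0 0.
  rewrite !mulmx_quadE !big_ord_recl !big_ord0 fE !hessian_meval.
  rewrite !mderivD !mevalD !meval_hessian_radial -/r ![B _ _]mxE /=; ring.
have := quad_form_norm_le (B := B) (b := C * N ^+ (2 * d).+1) w.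
move=> /(_ _)/wrap[i j|]; first by rewrite mxE; exact: HC N1 xj (i, j).
rewrite ler_norml => /andP[wB _].
have W0 := sum_sqr_gt0 w0.
have P2w : 0 <= (P^`()^`().[r] *+ 4) * (\sum_i x 0 i * w 0 i) ^+ 2.
  by rewrite mulr_ge0 ?sqr_ge0 ?mulrn_wge0.
have CP : C * N ^+ (2 * d).+1 < P^`().[r].
  apply: lt_le_trans P1; rewrite [in ltRHS]exprS mulrA ltr_pM2r //.
  by rewrite exprn_gt0 // (lt_le_trans ltr01).
(* The [p] part is at least $-2 C N^{2d+1} |w|^2$, the 2 being the dimension, and [CP] makes $2
   P'(r) |w|^2$ strictly outweigh it. *)
nra.
Qed.
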